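(* Let $\beta_0>0$ and $\beta_2\in(\beta_0,2\beta_0)$. Then there exists $B>\beta_0$ (depending on $\beta_0,\beta_2$) such that for every $\beta_1>B$ and every $n\ge5$, the shape process $H^n$ with parameter $(\beta_0,\beta_1,\beta_2)$ is transient.
   Context: For $n\ge2$ and $\beta=(\beta_0,\beta_1,\beta_2)\in(0,\infty)^3$: for $x\in\mathbb{N}^n$, with zero boundary convention $x(0)=x(n+1)=0$, let $V_j(x)=\mathbf 1_{\{x(j-1)>x(j)\}}+\mathbf 1_{\{x(j+1)>x(j)\}}$. The crystal process $X^n$ is the continuous-time Markov chain on $\mathbb{N}^n$ jumping from $x$ to $x+e_j$ at rate $\beta_{V_j(x)}$, no other transitions; its shape process is $H^n_t=(X^n_t(1)-X^n_t(2),\dots,X^n_t(n-1)-X^n_t(n))\in\mathbb{Z}^{n-1}$, a Markov chain. *)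

(* Defs.v *)
From Stdlib Require Import Reals ZArith Arith List Lia.
Import ListNotations.
Open Scope R_scope.

Definition beta (b0 b1 b2 : R) (v : nat) : R :=
  match v with 0%nat => b0 | 1%nat => b1 | _ => b2 end.

(** Crystal configurations x : nat -> Z, read on indices 1..n,
    with the zero boundary convention x(0) = x(n+1) = 0. *)
Definition bnd (n : nat) (x : nat -> Z) (i : nat) : Z :=
  if (Nat.eqb i 0 || Nat.ltb n i)%bool then 0%Z else x i.

Definition Vj (n : nat) (x : nat -> Z) (j : nat) : nat :=
  (Nat.b2n (Z.ltb (bnd n x j) (bnd n x (j - 1)))
   + Nat.b2n (Z.ltb (bnd n x j) (bnd n x (j + 1))))%nat.

(** Shapes: h : list Z of length n-1, h(k) = nth (k-1) h 0 for k = 1..n-1,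
    h(k) = x(k) - x(k+1). *)
Definition hk (h : list Z) (k : nat) : Z := nth (k - 1) h 0%Z.

(** A canonical lift of a shape h to a crystal configuration in N^n:
    x(i) = M + sum_{k=i}^{n-1} h(k), with M = sum |h(k)| so that x >= 0. *)
Definition lift (n : nat) (h : list Z) (i : nat) : Z :=
  (fold_right Z.add 0 (map Z.abs h)
   + fold_right Z.add 0 (map (hk h) (seq i (n - i))))%Z.

(** Shape after the crystal jump x -> x + e_j (1 <= j <= n):
    h(j-1) decreases by 1 (if j >= 2), h(j) increases by 1 (if j <= n-1). *)
Definition shape_step (n : nat) (h : list Z) (j : nat) : list Z :=
  map (fun k => (hk h k + (if Nat.eqb k j then 1 else 0)
                 - (if Nat.eqb (k + 1) j then 1 else 0))%Z)
      (seq 1 (n - 1)).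

Definition rate (n : nat) (b0 b1 b2 : R) (h : list Z) (j : nat) : R :=
  beta b0 b1 b2 (Vj n (lift n h) j).

Definition Rsum (f : nat -> R) (l : list nat) : R :=
  fold_right Rplus 0 (map f l).

Definition total_rate (n : nat) (b0 b1 b2 : R) (h : list Z) : R :=
  Rsum (rate n b0 b1 b2 h) (seq 1 n).

Definition jump_prob (n : nat) (b0 b1 b2 : R) (h : list Z) (j : nat) : R :=
  rate n b0 b1 b2 h j / total_rate n b0 b1 b2 h.

(** hit n b target N y = probability that the jump chain started at y
    visits target at some time in {1,...,N}. *)
Fixpoint hit (n : nat) (b0 b1 b2 : R) (target : list Z) (N : nat) (y : list Z) : R :=
  match N with
  | O => 0
  | S N' =>
      Rsum (fun j =>
              jump_prob n b0 b1 b2 y j *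
              (if list_eq_dec Z.eq_dec (shape_step n y j) target then 1
               else hit n b0 b1 b2 target N' (shape_step n y j)))
           (seq 1 n)
  end.

(** A state h is transient iff the probability of ever returning to h
    (= sup_N hit h N h) is < 1. *)
Definition transient_state (n : nat) (b0 b1 b2 : R) (h : list Z) : Prop :=
  exists c : R, c < 1 /\ forall N : nat, hit n b0 b1 b2 h N h <= c.

Definition shape_transient (n : nat) (b0 b1 b2 : R) : Prop :=
  forall h : list Z, length h = (n - 1)%nat -> transient_state n b0 b1 b2 h.

(* Main.v *)
(** For [b1] large, a block of two or three consecutive sites bounded by deep holes
    fills itself almost at once after each of its jumps, so it grows at speed close to
    [2 b0] or [3 b0], while a hole grows only at rate [b2 < 2 b0].  Cut [1..n] into blocks
    of width 2 and 3 separated by single holes (possible since [n >= 5]).  As long as the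
    holes stay below their neighbours the blocks evolve independently, and the holes sink
    linearly.  Quantitatively, every pair (hole [s], adjacent block) carries a function
    [W], roughly [z] to the power (height of the block above the hole), with a correction
    depending on the shape of the block, and the sum [F] of these functions is
    superharmonic where [F < q].  Hence [min F c / c] with [c = min q (F h)] dominates the
    probability of hitting [h].  Finally, raising all blocks [K] times without touching the
    holes multiplies [F] by [z ^ K] and never visits [h] again on the way. *)

Require Import Defs.
From Stdlib Require Import Reals ZArith Arith List Lia Lra Permutation Zify ZifyNat.
Import ListNotations.
Open Scope R_scope.

(** * Drift of a single block *)

(** Here [a] and [b] are the heights of the two sites above the hole. The factor [p < 1] credits an
    uneven block for the level it has begun, since its lower site is about to rise at rate [b1]. *)
Definition W2 (z p : R) (a b : Z) : R :=
  powerRZ z (Z.min a b) * (if Z.eqb a b then 1 else p).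

(* When the middle site is [d] below [min a c], the block grows only at speed [b0 < b2],
   but the middle catches up at rate [b2].  The factor [z ^ (-2 d)] charges for this
   delay: the exponent is [min a c - 2 d]. *)
Definition W3 (z p q : R) (a b c : Z) : R :=
  let m := Z.min a c in
  if Z.ltb b m then powerRZ z (2 * b - m)
  else powerRZ z m *
       (if Z.eqb b m then (if Z.eqb a c then 1 else p)
        else (if Z.eqb a c then p else q)).

(* [adm_flat] compensates the sinking term [b2 * (1 / z - 1)] on flat blocks, whose first
   jump gains a factor [p]; [adm_dip] does so when the middle of a wide block is too low.
   The last three fields say that all other shapes are left at the fast rate [b1]. *)
Record admissible (b0 b1 b2 z p q : R) : Prop := {
  adm_b0 : 0 < b0;
  adm_b02 : b0 < b2;
  adm_b1 : 0 < b1;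
  adm_z : 0 < z;
  adm_zq : z < q;
  adm_qp : q < p;
  adm_p : p < 1;
  adm_flat : b2 * (1 / z - 1) <= 2 * b0 * (1 - p);
  adm_dip : b2 * (1 / z - 1) <= b2 * (1 - z * z) - b0 * (1 / z - 1);
  adm_zp1 : b2 * (1 / z - 1) * p <= b1 * (p - z);
  adm_zq1 : b2 * (1 / z - 1) * q <= b1 * (q - z);
  adm_qp1 : b2 * (1 / z - 1) * p + b0 * (1 / z) <= b1 * (p - q) }.

Lemma powerRZ_succ (z : R) (k : Z) : 0 < z -> powerRZ z (k + 1) = powerRZ z k * z.
Proof. intros Hz. rewrite powerRZ_add by lra. now rewrite powerRZ_1. Qed.

Lemma powerRZ_pred (z : R) (k : Z) : 0 < z -> powerRZ z (k - 1) = powerRZ z k * (1 / z).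
Proof.
  intros Hz. replace (k - 1)%Z with (k + -1)%Z by lia.
  rewrite powerRZ_add by lra.
  replace (powerRZ z (-1)) with (1 / z); [reflexivity|]. simpl. field. lra.
Qed.

Lemma powerRZ_ge1 (z : R) (k : Z) : 0 < z < 1 -> (k <= 0)%Z -> 1 <= powerRZ z k.
Proof.
  intros Hz Hk. replace k with (- Z.of_nat (Z.to_nat (- k)))%Z by lia.
  rewrite powerRZ_neg', <- pow_powerRZ.
  set (m := Z.to_nat (- k)).
  assert (H : 0 < z ^ m) by (apply pow_lt; lra).
  assert (H1 : z ^ m <= 1 ^ m) by (apply pow_incr; lra).
  rewrite pow1 in H1. rewrite <- Rinv_1. apply Rinv_le_contravar; assumption.
Qed.

Ltac bool_cases :=
  repeat match goal with
  | |- context [Z.ltb ?a ?b] => destruct (Z.ltb_spec a b); try (exfalso; lia)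
  | |- context [Z.eqb ?a ?b] => destruct (Z.eqb_spec a b); try (exfalso; lia)
  end.


(** The pivot [m] is the exponent before the jump. A jump changes the exponent by -1, 0, 1 or 2,
    where -1 and 2 occur only for a wide block with a low middle, so [z ^ m] can be factored out. *)
Ltac powers_at z m Hz :=
  repeat match goal with
  | |- context [powerRZ z ?k] =>
      first [ constr_eq k m; fail 1
            | replace k with m by lia
            | replace k with (m + 1)%Z by lia; rewrite (powerRZ_succ z m Hz)
            | replace k with (m + 1 + 1)%Z by lia;
              rewrite (powerRZ_succ z (m + 1) Hz), (powerRZ_succ z m Hz)
            | replace k with (m - 1)%Z by lia; rewrite (powerRZ_pred z m Hz) ]
  end.

(* A drift inequality is [P] times an inequality between coefficients. *)
Lemma factor_le (P u v : R) : 0 < P -> u <= v -> u * P <= v * P.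
Proof. intros HP Huv. apply Rmult_le_compat_r; lra. Qed.

(** Both sides are linear in [P] without constant term, so their coefficients are their values at
    [P = 1]. *)
Ltac divide_by P HP :=
  match goal with |- ?u <= ?v =>
    let u' := eval pattern P in u in
    let v' := eval pattern P in v in
    match u' with ?f _ => match v' with ?g _ =>
      let u1 := eval cbv beta in (f 1) in
      let v1 := eval cbv beta in (g 1) in
      replace u with (u1 * P) by ring; replace v with (v1 * P) by ring;
      apply (factor_le P u1 v1 HP)
    end end
  end.

(** The rate [b2 * (1 / z - 1)] is what the block must win to balance a hole rising at rate [b2]. A
    flat block gains a factor [p] at rate [2 b0], which is [adm_flat]; on an uneven block the lower
    site rises at rate [b1], which is [adm_zp1], and a jump of the higher site changes nothing. *)
Lemma W2_drift (b0 b1 b2 z p q : R) (a b : Z) : admissible b0 b1 b2 z p q ->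
  beta b0 b1 b2 (Nat.b2n (Z.ltb a b)) * (W2 z p (a + 1) b - W2 z p a b)
  + beta b0 b1 b2 (Nat.b2n (Z.ltb b a)) * (W2 z p a (b + 1) - W2 z p a b)
  <= - (b2 * (1 / z - 1)) * W2 z p a b.
Proof.
  intros [].
  unfold W2.
  assert (Hm : exists m, m = Z.min a b) by eauto. destruct Hm as [m Hm].
  assert (P : 0 < powerRZ z m) by (apply powerRZ_lt; assumption).
  (* If the block stays uneven after its lower site rises, the gain is [b1 * (p - p * z)], larger
     than the [b1 * (p - z)] of [adm_zp1] by this amount. *)
  assert (Hp : 0 <= b1 * z * (1 - p))
    by (apply Rmult_le_pos; [apply Rmult_le_pos|]; lra).
  bool_cases; cbn [Nat.b2n beta]; powers_at z m adm_z0;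
    revert P; generalize (powerRZ z m) as P; intros P HP; divide_by P HP; lra.
Qed.

(** A flat block gains a factor [p] at rate [3 b0]. With a low middle, at most one end is the strict
    minimum and costs a factor [1 / z] at rate [b0], while the middle wins [z * z] or better at rate
    [b2]: [adm_dip]. If the middle is level with a strictly lower end, it rises at rate [b1] and
    turns [p] into [q], against the risk that this end rises first and creates a dip: [adm_qp1]. If
    the middle is above two equal ends, each of them turns [p] into [q] at rate [b1]; if it is above
    a strictly lower end, that end completes a level at rate [b1]: [adm_zq1]. *)
Lemma W3_drift (b0 b1 b2 z p q : R) (a b c : Z) : admissible b0 b1 b2 z p q ->
  beta b0 b1 b2 (Nat.b2n (Z.ltb a b)) * (W3 z p q (a + 1) b c - W3 z p q a b c)
  + beta b0 b1 b2 (Nat.b2n (Z.ltb b a) + Nat.b2n (Z.ltb b c))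
    * (W3 z p q a (b + 1) c - W3 z p q a b c)
  + beta b0 b1 b2 (Nat.b2n (Z.ltb c b)) * (W3 z p q a b (c + 1) - W3 z p q a b c)
  <= - (b2 * (1 / z - 1)) * W3 z p q a b c.
Proof.
  intros [].
  unfold W3; cbv zeta.
  assert (Hm : exists m, m = if Z.ltb b (Z.min a c) then (2 * b - Z.min a c)%Z
                             else Z.min a c) by eauto.
  destruct Hm as [m Hm].
  assert (P : 0 < powerRZ z m) by (apply powerRZ_lt; assumption).
  assert (Hp : 0 <= b1 * z * (1 - p))
    by (apply Rmult_le_pos; [apply Rmult_le_pos|]; lra).
  assert (Hq : 0 <= b1 * z * (1 - q))
    by (apply Rmult_le_pos; [apply Rmult_le_pos|]; lra).
  assert (Hpz : 0 <= b2 * (z * z) * (1 - p))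
    by (apply Rmult_le_pos; [apply Rmult_le_pos; [|apply Rmult_le_pos]|]; lra).
  assert (Hi : 0 <= b0 * (1 / z - 1)).
  { apply Rmult_le_pos; [lra|]. enough (1 < 1 / z) by lra.
    apply (Rmult_lt_reg_l z); [lra|]. replace (z * (1 / z)) with 1 by (field; lra).
    lra. }
  assert (Hb0 : 0 <= b0 * p /\ 0 <= b0 * (1 - p) /\ 0 <= b1 * (p - q))
    by (repeat split; apply Rmult_le_pos; lra).
  revert Hm.
  destruct (Z.lt_trichotomy a c) as [Hac|[Hac|Hac]];
    bool_cases; intros Hm; cbn [Nat.b2n beta Nat.add]; powers_at z m adm_z0;
    revert P; generalize (powerRZ z m) as P; intros P HP; divide_by P HP; lra.
Qed.

Lemma W2_lower (b0 b1 b2 z p q : R) (a b : Z) :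
  admissible b0 b1 b2 z p q -> (Z.min a b <= 0)%Z -> q <= W2 z p a b.
Proof.
  intros [] H. unfold W2.
  assert (P := powerRZ_ge1 z (Z.min a b) ltac:(lra) H).
  destruct (Z.eqb a b); nra.
Qed.

Lemma W3_lower (b0 b1 b2 z p q : R) (a b c : Z) :
  admissible b0 b1 b2 z p q -> (Z.min a c <= 0)%Z -> q <= W3 z p q a b c.
Proof.
  intros [] H. unfold W3; cbv zeta. destruct (Z.ltb_spec b (Z.min a c)).
  - assert (P := powerRZ_ge1 z (2 * b - Z.min a c) ltac:(lra) ltac:(lia)). lra.
  - assert (P := powerRZ_ge1 z (Z.min a c) ltac:(lra) H).
    destruct (Z.eqb b _), (Z.eqb a c); nra.
Qed.

Lemma W2_pos (b0 b1 b2 z p q : R) (a b : Z) :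
  admissible b0 b1 b2 z p q -> 0 < W2 z p a b.
Proof.
  intros []. unfold W2. apply Rmult_lt_0_compat; [apply powerRZ_lt; lra|].
  destruct (Z.eqb a b); lra.
Qed.

Lemma W3_pos (b0 b1 b2 z p q : R) (a b c : Z) :
  admissible b0 b1 b2 z p q -> 0 < W3 z p q a b c.
Proof.
  intros []. unfold W3; cbv zeta.
  destruct (Z.ltb b _); [apply powerRZ_lt; lra|].
  apply Rmult_lt_0_compat; [apply powerRZ_lt; lra|].
  destruct (Z.eqb b _), (Z.eqb a c); lra.
Qed.

Lemma W2_shift (z p : R) (a b k : Z) : 0 < z ->
  W2 z p (a + k) (b + k) = powerRZ z k * W2 z p a b.
Proof.
  intros Hz. unfold W2.
  replace (Z.min (a + k) (b + k)) with (Z.min a b + k)%Z by lia.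
  rewrite powerRZ_add by lra. bool_cases; ring.
Qed.

Lemma W3_shift (z p q : R) (a b c k : Z) : 0 < z ->
  W3 z p q (a + k) (b + k) (c + k) = powerRZ z k * W3 z p q a b c.
Proof.
  intros Hz. unfold W3; cbv zeta.
  replace (Z.min (a + k) (c + k)) with (Z.min a c + k)%Z by lia.
  replace (2 * (b + k) - (Z.min a c + k))%Z with (2 * b - Z.min a c + k)%Z by lia.
  rewrite !powerRZ_add by lra. bool_cases; ring.
Qed.

(** After division by [1 - z], the limit [z -> 1] turns [adm_flat] with [z < p] into [b2 < 2 b0],
    and [adm_dip] into [b0 < b2]. So any [z < 1] close enough to 1 will do, and [b1] is chosen
    last. *)
Lemma admissible_exists (b0 b2 : R) : 0 < b0 -> b0 < b2 -> b2 < 2 * b0 ->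
  exists z p q B : R, B > b0 /\ forall b1, b1 > B -> admissible b0 b1 b2 z p q.
Proof.
  intros H0 H1 H2.
  assert (exists z, 0 < z < 1 /\ b2 < 2 * b0 * z /\ b0 + b2 <= b2 * (z * (1 + z)))
    as (z & Hz & Hz1 & Hz2).
  { set (r1 := b2 / (2 * b0)). set (r2 := (b0 + b2) / (2 * b2)).
    assert (E1 : b2 = 2 * b0 * r1) by (unfold r1; field; lra).
    assert (E2 : b0 + b2 = 2 * b2 * r2) by (unfold r2; field; lra).
    assert (0 < r1 < 1) by nra. assert (0 < r2 < 1) by nra.
    assert (Hr : r1 <= Rmax r1 r2 /\ r2 <= Rmax r1 r2 /\ Rmax r1 r2 < 1).
    { split; [apply Rmax_l|split; [apply Rmax_r|]]. apply Rmax_lub_lt; lra. }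
    destruct Hr as (Ha & Hb & Hc). generalize dependent (Rmax r1 r2). intros r Ha Hb Hc.
    (* The second condition holds because [z * (1 + z) - 2 * r = (1 - r) * (3 - r) / 4]. *)
    exists ((1 + r) / 2). split; [lra|]. split.
    - rewrite E1 at 1. apply Rmult_lt_compat_l; lra.
    - rewrite E2. replace (2 * b2 * r2) with (b2 * (2 * r2)) by ring.
      apply Rmult_le_compat_l; [lra|]. nra. }
  set (lam := b2 * (1 / z - 1)).
  assert (Elam : lam * z = b2 * (1 - z)) by (unfold lam; field; lra).
  assert (Hlam : 0 < lam) by nra.
  (* This makes [adm_flat] an equality, and [z < p] is then [b2 < 2 * b0 * z]. *)
  set (p := 1 - lam / (2 * b0)).
  assert (Ep : lam = 2 * b0 * (1 - p)) by (unfold p; field; lra).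
  assert (Hp : z < p < 1) by (split; nra).
  set (q := (z + p) / 2).
  assert (Hq : z < q < p) by (unfold q; lra).
  (* The three quotients are the lower bounds on [b1] required by the last three fields. *)
  set (B := b0 + lam * p / (p - z) + lam * q / (q - z)
            + (lam * p + b0 * (1 / z)) / (p - q)).
  assert (A1 : 0 < lam * p / (p - z)) by (apply Rdiv_lt_0_compat; nra).
  assert (A2 : 0 < lam * q / (q - z)) by (apply Rdiv_lt_0_compat; nra).
  assert (Hiz : 0 < 1 / z) by (apply Rdiv_lt_0_compat; lra).
  assert (A3 : 0 < (lam * p + b0 * (1 / z)) / (p - q))
    by (apply Rdiv_lt_0_compat; nra).
  exists z, p, q, B. split; [unfold B; lra|].
  intros b1 Hb1.
  assert (div_bound : forall u v, 0 < v -> u / v <= b1 -> u <= b1 * v).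
  { intros u v Hv Huv. replace u with (u / v * v) by (field; lra).
    apply Rmult_le_compat_r; lra. }
  unfold B in Hb1.
  constructor; fold lam; try lra; try (apply div_bound; lra).
  (* For [adm_dip]: once multiplied by [z], both sides contain the factor [1 - z], and [Hz2]
     remains. *)
  replace (b0 * (1 / z - 1)) with (b0 * (1 - z) * (1 / z)) by (field; lra).
  apply (Rmult_le_reg_r z); [lra|]. rewrite Elam.
  replace ((b2 * (1 - z * z) - b0 * (1 - z) * (1 / z)) * z) with
    ((1 - z) * (b2 * (z * (1 + z)) - b0)) by (field; lra).
  nra.
Qed.

(** * Finite sums and hitting probabilities *)

Lemma Rsum_cons (f : nat -> R) (a : nat) (l : list nat) :
  Rsum f (a :: l) = f a + Rsum f l.
Proof. reflexivity. Qed.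

Lemma Rsum_ext (f g : nat -> R) (l : list nat) :
  (forall j, In j l -> f j = g j) -> Rsum f l = Rsum g l.
Proof.
  induction l as [|a l IH]; intros H; [reflexivity|].
  rewrite !Rsum_cons, H, IH; auto with datatypes.
Qed.

Lemma Rsum_le (f g : nat -> R) (l : list nat) :
  (forall j, In j l -> f j <= g j) -> Rsum f l <= Rsum g l.
Proof.
  induction l as [|a l IH]; intros H; [apply Rle_refl|].
  rewrite !Rsum_cons. apply Rplus_le_compat; auto with datatypes.
Qed.

Lemma Rsum_zero (l : list nat) : Rsum (fun _ => 0) l = 0.
Proof. induction l as [|a l IH]; [reflexivity|]. rewrite Rsum_cons, IH. ring. Qed.

Lemma Rsum_plus (f g : nat -> R) (l : list nat) :
  Rsum (fun j => f j + g j) l = Rsum f l + Rsum g l.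
Proof.
  induction l as [|a l IH]; [unfold Rsum; simpl; ring|].
  rewrite !Rsum_cons, IH. ring.
Qed.

Lemma Rsum_scal (c : R) (f : nat -> R) (l : list nat) :
  Rsum (fun j => c * f j) l = c * Rsum f l.
Proof.
  induction l as [|a l IH]; [unfold Rsum; simpl; ring|].
  rewrite !Rsum_cons, IH. ring.
Qed.

Lemma Rsum_swap (f : nat -> nat -> R) (l m : list nat) :
  Rsum (fun i => Rsum (f i) m) l = Rsum (fun j => Rsum (fun i => f i j) l) m.
Proof.
  induction l as [|a l IH].
  - symmetry. apply Rsum_zero.
  - rewrite Rsum_cons, IH, <- Rsum_plus. reflexivity.
Qed.

Lemma Rsum_le_minus (f g : nat -> R) (l : list nat) (i : nat) (d : R) :
  (forall j, In j l -> f j <= g j) -> In i l -> f i <= g i - d ->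
  Rsum f l <= Rsum g l - d.
Proof.
  intros H Hi Hd. induction l as [|a l IH]; [destruct Hi|].
  rewrite !Rsum_cons. destruct Hi as [->|Hi].
  - assert (Rsum f l <= Rsum g l) by (apply Rsum_le; auto with datatypes). lra.
  - assert (f a <= g a) by auto with datatypes.
    assert (Rsum f l <= Rsum g l - d) by auto with datatypes. lra.
Qed.

Lemma Rsum_ge_term (f : nat -> R) (l : list nat) (i : nat) :
  (forall j, In j l -> 0 <= f j) -> In i l -> f i <= Rsum f l.
Proof.
  intros H Hi.
  assert (H1 := Rsum_le_minus (fun _ => 0) f l i (f i) H Hi ltac:(lra)).
  rewrite Rsum_zero in H1. lra.
Qed.

Lemma Rsum_perm (f : nat -> R) (l m : list nat) :
  Permutation l m -> Rsum f l = Rsum f m.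
Proof.
  induction 1; rewrite ?Rsum_cons in *; try lra; reflexivity.
Qed.

Lemma Rsum_support (f : nat -> R) (l m : list nat) :
  NoDup l -> NoDup m -> incl l m ->
  (forall j, In j m -> ~ In j l -> f j = 0) -> Rsum f m = Rsum f l.
Proof.
  intros Hl Hm Hlm H0.
  set (inl := fun j => if in_dec Nat.eq_dec j l then true else false).
  transitivity (Rsum f (filter inl m)).
  - clear Hm Hlm. induction m as [|a m IH]; [reflexivity|].
    rewrite Rsum_cons, IH by auto with datatypes. simpl. unfold inl at 2.
    destruct (in_dec Nat.eq_dec a l) as [|Ha]; [reflexivity|].
    rewrite (H0 a) by auto with datatypes. ring.
  - apply Rsum_perm, NoDup_Permutation; [now apply NoDup_filter|assumption|].
    intros j. rewrite filter_In. unfold inl.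
    destruct (in_dec Nat.eq_dec j l) as [H|H]; split; try tauto.
    + intros _. auto.
    + now intros [_ ?].
Qed.

Lemma beta_pos (b0 b1 b2 : R) (v : nat) :
  0 < b0 -> 0 < b1 -> 0 < b2 -> 0 < beta b0 b1 b2 v.
Proof. intros. destruct v as [|[|v]]; assumption. Qed.

Lemma total_rate_pos (n : nat) (b0 b1 b2 : R) (h : list Z) :
  (1 <= n)%nat -> 0 < b0 -> 0 < b1 -> 0 < b2 -> 0 < total_rate n b0 b1 b2 h.
Proof.
  intros Hn H0 H1 H2.
  apply Rlt_le_trans with (rate n b0 b1 b2 h 1); [now apply beta_pos|].
  apply Rsum_ge_term; [|apply in_seq; lia].
  intros j _. now apply Rlt_le, beta_pos.
Qed.

Lemma jump_prob_pos (n : nat) (b0 b1 b2 : R) (h : list Z) (j : nat) :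
  (1 <= n)%nat -> 0 < b0 -> 0 < b1 -> 0 < b2 -> 0 < jump_prob n b0 b1 b2 h j.
Proof.
  intros. apply Rdiv_lt_0_compat; [now apply beta_pos|now apply total_rate_pos].
Qed.

Lemma jump_prob_sum (n : nat) (b0 b1 b2 : R) (h : list Z) :
  (1 <= n)%nat -> 0 < b0 -> 0 < b1 -> 0 < b2 ->
  Rsum (jump_prob n b0 b1 b2 h) (seq 1 n) = 1.
Proof.
  intros Hn H0 H1 H2.
  assert (HT := total_rate_pos n b0 b1 b2 h Hn H0 H1 H2).
  rewrite (Rsum_ext _ (fun j => / total_rate n b0 b1 b2 h * rate n b0 b1 b2 h j)).
  - rewrite Rsum_scal. change (Rsum _ _) with (total_rate n b0 b1 b2 h). field. lra.
  - intros j _. unfold jump_prob. field. lra.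
Qed.

(** Induction on the time horizon: the value 1 that [hit] assigns to an arrival at [h] is dominated
    by [G h], the other values by the induction hypothesis. *)
Lemma hit_le_supersolution (n : nat) (b0 b1 b2 : R) (h : list Z) (G : list Z -> R) :
  (1 <= n)%nat -> 0 < b0 -> 0 < b1 -> 0 < b2 ->
  (forall y, 0 <= G y) -> 1 <= G h ->
  (forall y, Rsum (fun j => jump_prob n b0 b1 b2 y j * G (shape_step n y j)) (seq 1 n)
             <= G y) ->
  forall N y, hit n b0 b1 b2 h N y <= G y.
Proof.
  intros Hn H0 H1 H2 Gpos Gh Gsup. induction N as [|N IH]; intros y; [apply Gpos|].
  eapply Rle_trans; [|apply Gsup].
  simpl. apply Rsum_le. intros j _.
  apply Rmult_le_compat_l; [now apply Rlt_le, jump_prob_pos|].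
  destruct (list_eq_dec _ _ _) as [->|]; [exact Gh|apply IH].
Qed.

Lemma hit_le_1 (n : nat) (b0 b1 b2 : R) (h : list Z) :
  (1 <= n)%nat -> 0 < b0 -> 0 < b1 -> 0 < b2 ->
  forall N y, hit n b0 b1 b2 h N y <= 1.
Proof.
  intros Hn H0 H1 H2.
  apply (hit_le_supersolution n b0 b1 b2 h (fun _ => 1)); try assumption; intros; try lra.
  rewrite (Rsum_ext _ (jump_prob n b0 b1 b2 y)) by (intros; ring).
  rewrite jump_prob_sum by assumption. lra.
Qed.

(** For [y = h] this is [transient_state]. The free starting point allows the bound to be pulled
    back along a path. *)
Definition escapes (n : nat) (b0 b1 b2 : R) (h y : list Z) : Prop :=
  exists c : R, c < 1 /\ forall N : nat, hit n b0 b1 b2 h N y <= c.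

Lemma escapes_step (n : nat) (b0 b1 b2 : R) (h y : list Z) (j : nat) :
  0 < b0 -> 0 < b1 -> 0 < b2 -> (1 <= j <= n)%nat ->
  shape_step n y j <> h -> escapes n b0 b1 b2 h (shape_step n y j) ->
  escapes n b0 b1 b2 h y.
Proof.
  intros H0 H1 H2 Hj Hne (c & Hc & Hhit).
  assert (Hp := jump_prob_pos n b0 b1 b2 y j ltac:(lia) H0 H1 H2).
  set (d := jump_prob n b0 b1 b2 y j * (1 - c)).
  assert (Hd : 0 < d) by (apply Rmult_lt_0_compat; lra).
  (* The jump to [shape_step n y j] loses at least [d] from the total probability 1; the 0 covers
     [N = 0]. *)
  exists (Rmax 0 (1 - d)). split; [apply Rmax_lub_lt; lra|].
  intros [|N]; [apply Rmax_l|]. eapply Rle_trans; [|apply Rmax_r].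
  rewrite <- (jump_prob_sum n b0 b1 b2 y) by (assumption || lia).
  simpl. apply (Rsum_le_minus _ _ _ j).
  - intros i _. rewrite <- (Rmult_1_r (jump_prob n b0 b1 b2 y i)) at 2.
    apply Rmult_le_compat_l; [apply Rlt_le, jump_prob_pos; (assumption || lia)|].
    destruct (list_eq_dec _ _ _); [lra|apply hit_le_1; (assumption || lia)].
  - apply in_seq. lia.
  - destruct (list_eq_dec _ _ _) as [E|]; [contradiction|].
    unfold d. specialize (Hhit N). nra.
Qed.

Definition walk (n : nat) (h : list Z) (p : list nat) : list Z :=
  fold_left (shape_step n) p h.

(** The bound is pulled back through the last jump of the path, so the start [h] stays fixed in the
    induction. *)
Lemma escapes_walk (n : nat) (b0 b1 b2 : R) (h : list Z) (p : list nat) :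
  0 < b0 -> 0 < b1 -> 0 < b2 ->
  (forall j, In j p -> (1 <= j <= n)%nat) ->
  (forall p1 j p2, p = p1 ++ j :: p2 -> walk n h (p1 ++ [j]) <> h) ->
  escapes n b0 b1 b2 h (walk n h p) -> escapes n b0 b1 b2 h h.
Proof.
  intros H0 H1 H2. induction p as [|j p IH] using rev_ind; intros Hin Hne Hesc;
    [exact Hesc|].
  apply IH.
  - intros i Hi. apply Hin, in_or_app. now left.
  - intros p1 i p2 ->. apply (Hne p1 i (p2 ++ [j])). now rewrite <- app_assoc.
  - apply (escapes_step _ _ _ _ _ _ j); try assumption.
    + apply Hin, in_or_app. right. now left.
    + specialize (Hne p j [] eq_refl). unfold walk in Hne.
      now rewrite fold_left_app in Hne.
    + unfold walk in Hesc. now rewrite fold_left_app in Hesc.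
Qed.

(** * Heights of the lifted configuration *)

Lemma lift_succ (n : nat) (h : list Z) (i : nat) : (i < n)%nat ->
  lift n h i = (lift n h (i + 1) + hk h i)%Z.
Proof.
  intros Hi. unfold lift. replace (n - i)%nat with (S (n - (i + 1))) by lia.
  replace (i + 1)%nat with (S i) by lia. simpl. lia.
Qed.

Lemma sum_abs_nth (h : list Z) (i m : nat) :
  (fold_right Z.add 0 (map (fun k => Z.abs (nth k h 0)) (seq i m))
   <= fold_right Z.add 0 (map Z.abs h))%Z.
Proof.
  revert i m. induction h as [|a h IH]; intros i m.
  - revert i. induction m as [|m IHm]; intros i; simpl; [lia|].
    specialize (IHm (S i)). simpl in IHm. destruct i; lia.
  - destruct i as [|i]; [destruct m as [|m]|]; simpl.
    + specialize (IH 0%nat 0%nat). simpl in IH. lia.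
    + rewrite <- seq_shift, map_map. specialize (IH 0%nat m). simpl in *. lia.
    + rewrite <- seq_shift, map_map. specialize (IH i m). simpl in *. lia.
Qed.

(** The sum of absolute values in [lift] dominates every partial sum of increments. Nonnegativity
    ensures that the boundary sites, at height 0, never speed up a block. *)
Lemma lift_nonneg (n : nat) (h : list Z) (i : nat) : (1 <= i)%nat -> (0 <= lift n h i)%Z.
Proof.
  intros Hi. unfold lift.
  assert (H := sum_abs_nth h (i - 1) (n - i)).
  enough (- fold_right Z.add 0 (map (fun k => Z.abs (nth k h 0)) (seq (i - 1) (n - i)))
          <= fold_right Z.add 0 (map (hk h) (seq i (n - i))))%Z by lia.
  clear H. generalize (n - i)%nat as m. intros m. revert i Hi.
  induction m as [|m IH]; intros i Hi; simpl; [lia|].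
  specialize (IH (S i) ltac:(lia)). unfold hk at 1.
  replace (S i - 1)%nat with (S (i - 1)) in IH by lia. lia.
Qed.

Lemma hk_step (n : nat) (h : list Z) (j k : nat) : (1 <= k < n)%nat ->
  hk (shape_step n h j) k = (hk h k + (if Nat.eqb k j then 1 else 0)
                             - (if Nat.eqb (k + 1) j then 1 else 0))%Z.
Proof.
  intros Hk. unfold hk at 1, shape_step.
  set (g := fun k => _).
  rewrite (nth_indep _ 0%Z (g 0%nat)) by (rewrite length_map, length_seq; lia).
  rewrite map_nth, seq_nth by lia. unfold g.
  now replace (1 + (k - 1))%nat with k by lia.
Qed.

Lemma lift_step (n : nat) (h : list Z) (j : nat) : exists c : Z,
  forall i, (1 <= i <= n)%nat ->
  lift n (shape_step n h j) i = (lift n h i + (if Nat.eqb i j then 1 else 0) + c)%Z.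
Proof.
  (* The normalising constant of [lift] changes with the shape. This [c] gives equality at site [n],
     and equal increments carry it down to site 1. *)
  exists (lift n (shape_step n h j) n - lift n h n - (if Nat.eqb n j then 1 else 0))%Z.
  intros i Hi. replace i with (n - (n - i))%nat by lia.
  assert (Hm : (n - i < n)%nat) by lia. revert Hm. generalize (n - i)%nat as m.
  induction m as [|m IH]; intros Hm; [rewrite Nat.sub_0_r; lia|].
  rewrite (lift_succ n h (n - S m)), (lift_succ n (shape_step n h j) (n - S m)) by lia.
  rewrite hk_step by lia.
  replace (n - S m + 1)%nat with (n - m)%nat by lia.
  rewrite IH by lia. lia.
Qed.

Lemma lift_walk (n : nat) (h : list Z) (p : list nat) : exists c : Z,
  forall i, (1 <= i <= n)%nat ->
  lift n (walk n h p) i = (lift n h i + Z.of_nat (count_occ Nat.eq_dec p i) + c)%Z.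
Proof.
  induction p as [|j p IH] using rev_ind.
  - exists 0%Z. intros i _. simpl. lia.
  - destruct IH as [c IH]. destruct (lift_step n (walk n h p) j) as [d Hd].
    exists (c + d)%Z. intros i Hi.
    unfold walk at 1. rewrite fold_left_app. simpl. fold (walk n h p).
    rewrite Hd, IH, count_occ_app by assumption. simpl.
    destruct (Nat.eq_dec j i), (Nat.eqb_spec i j); lia.
Qed.

(* The shape determines the heights up to a common shift, and the height of [s] is kept. *)
Lemma walk_neq (n : nat) (h : list Z) (p1 : list nat) (j s : nat) :
  (1 <= s <= n)%nat -> (1 <= j <= n)%nat -> ~ In s (p1 ++ [j]) ->
  walk n h (p1 ++ [j]) <> h.
Proof.
  intros Hs Hj Hin E. destruct (lift_walk n h (p1 ++ [j])) as [c Hc].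
  rewrite E in Hc.
  assert (Es := Hc s Hs). assert (Ej := Hc j Hj).
  rewrite (proj1 (count_occ_not_In Nat.eq_dec _ _) Hin) in Es.
  rewrite count_occ_app in Ej. simpl in Ej.
  destruct (Nat.eq_dec j j); [lia|congruence].
Qed.

(** * The potential of a configuration *)

(* The walls, including the two boundary sites [0] and [n + 1], are spaced by gaps
   of 4 up to [4 * r] and by gaps of 3 afterwards, where [n + 1 = 4 r + 3 k]. *)
Definition wide_gaps (n : nat) : nat := (n + 1) mod 3.

Definition wall (r w : nat) : bool :=
  if Nat.leb w (4 * r) then Nat.eqb (w mod 4) 0 else Nat.eqb ((w - 4 * r) mod 3) 0.

Definition block_term (z p q : R) (wide : bool) (x : nat -> Z) (s i1 i2 i3 : nat) : R :=
  if wide then W3 z p q (x i1 - x s) (x i2 - x s) (x i3 - x s)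
  else W2 z p (x i1 - x s) (x i2 - x s).

(** At [s = 4 * r] the block on the left is wide and the one on the right narrow, hence [Nat.leb]
    against [Nat.ltb]. Sites are listed going away from the hole. *)
Definition wall_term (z p q : R) (r : nat) (x : nat -> Z) (s : nat) : R :=
  if wall r s then
    block_term z p q (Nat.leb s (4 * r)) x s (s - 1) (s - 2) (s - 3)
    + block_term z p q (Nat.ltb s (4 * r)) x s (s + 1) (s + 2) (s + 3)
  else 0.

(** Only interior walls carry a term; a block between two of them is counted once from each side. *)
Definition potential (z p q : R) (n : nat) (x : nat -> Z) : R :=
  Rsum (wall_term z p q (wide_gaps n) x) (seq 1 n).

Definition bump (x : nat -> Z) (j i : nat) : Z := (x i + (if Nat.eqb i j then 1 else 0))%Z.

(** The generator of the crystal process applied to [f]. *)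
Definition drift (n : nat) (b0 b1 b2 : R) (f : (nat -> Z) -> R) (x : nat -> Z) : R :=
  Rsum (fun j => beta b0 b1 b2 (Vj n x j) * (f (bump x j) - f x)) (seq 1 n).

Lemma bump_same (x : nat -> Z) (j : nat) : bump x j j = (x j + 1)%Z.
Proof. unfold bump. now rewrite Nat.eqb_refl. Qed.

Lemma bump_other (x : nat -> Z) (j i : nat) : i <> j -> bump x j i = x i.
Proof. intros H. unfold bump. apply Nat.eqb_neq in H. rewrite H. lia. Qed.

Lemma W2_sink (z p : R) (a b : Z) : 0 < z ->
  W2 z p (a - 1) (b - 1) = W2 z p a b * (1 / z).
Proof.
  intros Hz. change (a - 1)%Z with (a + -1)%Z. change (b - 1)%Z with (b + -1)%Z.
  rewrite W2_shift by assumption. simpl. field. lra.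
Qed.

Lemma W3_sink (z p q : R) (a b c : Z) : 0 < z ->
  W3 z p q (a - 1) (b - 1) (c - 1) = W3 z p q a b c * (1 / z).
Proof.
  intros Hz. change (a - 1)%Z with (a + -1)%Z. change (b - 1)%Z with (b + -1)%Z.
  change (c - 1)%Z with (c + -1)%Z.
  rewrite W3_shift by assumption. simpl. field. lra.
Qed.

Lemma drift_support (n : nat) (b0 b1 b2 : R) (f : (nat -> Z) -> R) (x : nat -> Z)
  (l : list nat) :
  NoDup l -> incl l (seq 1 n) -> (forall j, ~ In j l -> f (bump x j) = f x) ->
  drift n b0 b1 b2 f x =
  Rsum (fun j => beta b0 b1 b2 (Vj n x j) * (f (bump x j) - f x)) l.
Proof.
  intros Hl Hi Hf. apply Rsum_support; [assumption|apply seq_NoDup|assumption|].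
  intros j _ Hj. rewrite Hf by assumption. ring.
Qed.

(** A jump of the hole multiplies the term by [1 / z] at rate [b2], and the decay from [W2_drift]
    cancels exactly this growth. *)
Lemma narrow_term_drift (b0 b1 b2 z p q : R) (n : nat) (x : nat -> Z) (s i1 i2 i3 : nat) :
  admissible b0 b1 b2 z p q -> NoDup [s; i1; i2] -> incl [s; i1; i2] (seq 1 n) ->
  Vj n x s = 2%nat ->
  Vj n x i1 = Nat.b2n (Z.ltb (x i1) (x i2)) ->
  Vj n x i2 = Nat.b2n (Z.ltb (x i2) (x i1)) ->
  drift n b0 b1 b2 (fun x => block_term z p q false x s i1 i2 i3) x <= 0.
Proof.
  intros Hadm Hnd Hincl Vs V1 V2.
  rewrite (drift_support _ _ _ _ _ _ [s; i1; i2]); try assumption.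
  - assert (Hz := adm_z _ _ _ _ _ _ Hadm).
    assert (D := W2_drift b0 b1 b2 z p q (x i1 - x s) (x i2 - x s) Hadm).
    rewrite !NoDup_cons_iff in Hnd. simpl in Hnd.
    unfold block_term, Rsum; simpl.
    rewrite !bump_same, !bump_other by intuition congruence.
    rewrite Vs, V1, V2. simpl.
    replace (x i1 - (x s + 1))%Z with (x i1 - x s - 1)%Z by lia.
    replace (x i2 - (x s + 1))%Z with (x i2 - x s - 1)%Z by lia.
    replace (x i1 + 1 - x s)%Z with (x i1 - x s + 1)%Z by lia.
    replace (x i2 + 1 - x s)%Z with (x i2 - x s + 1)%Z by lia.
    rewrite W2_sink by assumption.
    replace (x i1 - x s <? x i2 - x s)%Z with (x i1 <? x i2)%Z in D
      by (bool_cases; reflexivity).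
    replace (x i2 - x s <? x i1 - x s)%Z with (x i2 <? x i1)%Z in D
      by (bool_cases; reflexivity).
    lra.
  - intros j Hj. simpl in Hj. unfold block_term. rewrite !bump_other by intuition congruence.
    reflexivity.
Qed.

Lemma wide_term_drift (b0 b1 b2 z p q : R) (n : nat) (x : nat -> Z) (s i1 i2 i3 : nat) :
  admissible b0 b1 b2 z p q -> NoDup [s; i1; i2; i3] -> incl [s; i1; i2; i3] (seq 1 n) ->
  Vj n x s = 2%nat ->
  Vj n x i1 = Nat.b2n (Z.ltb (x i1) (x i2)) ->
  Vj n x i2 = (Nat.b2n (Z.ltb (x i2) (x i1)) + Nat.b2n (Z.ltb (x i2) (x i3)))%nat ->
  Vj n x i3 = Nat.b2n (Z.ltb (x i3) (x i2)) ->
  drift n b0 b1 b2 (fun x => block_term z p q true x s i1 i2 i3) x <= 0.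
Proof.
  intros Hadm Hnd Hincl Vs V1 V2 V3.
  rewrite (drift_support _ _ _ _ _ _ [s; i1; i2; i3]); try assumption.
  - assert (Hz := adm_z _ _ _ _ _ _ Hadm).
    assert (D := W3_drift b0 b1 b2 z p q (x i1 - x s) (x i2 - x s) (x i3 - x s) Hadm).
    rewrite !NoDup_cons_iff in Hnd. simpl in Hnd.
    unfold block_term, Rsum; simpl.
    rewrite !bump_same, !bump_other by intuition congruence.
    rewrite Vs, V1, V2, V3. simpl.
    replace (x i1 - (x s + 1))%Z with (x i1 - x s - 1)%Z by lia.
    replace (x i2 - (x s + 1))%Z with (x i2 - x s - 1)%Z by lia.
    replace (x i3 - (x s + 1))%Z with (x i3 - x s - 1)%Z by lia.
    replace (x i1 + 1 - x s)%Z with (x i1 - x s + 1)%Z by lia.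
    replace (x i2 + 1 - x s)%Z with (x i2 - x s + 1)%Z by lia.
    replace (x i3 + 1 - x s)%Z with (x i3 - x s + 1)%Z by lia.
    rewrite W3_sink by assumption.
    replace (x i1 - x s <? x i2 - x s)%Z with (x i1 <? x i2)%Z in D
      by (bool_cases; reflexivity).
    replace (x i2 - x s <? x i1 - x s)%Z with (x i2 <? x i1)%Z in D
      by (bool_cases; reflexivity).
    replace (x i2 - x s <? x i3 - x s)%Z with (x i2 <? x i3)%Z in D
      by (bool_cases; reflexivity).
    replace (x i3 - x s <? x i2 - x s)%Z with (x i3 <? x i2)%Z in D
      by (bool_cases; reflexivity).
    lra.
  - intros j Hj. simpl in Hj. unfold block_term. rewrite !bump_other by intuition congruence.
    reflexivity.
Qed.

(** * Positions of the walls *)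

Ltac Zify.zify_post_hook ::= Z.div_mod_to_equations.

(** From [n >= 5] follows [4 * wide_gaps n <= n + 1], and the remaining length is a multiple of 3.
    So the gaps fit and the last wall is [n + 1]. *)
Lemma wall_right (n s : nat) : (5 <= n)%nat -> (1 <= s <= n)%nat ->
  wall (wide_gaps n) s = true ->
  if Nat.ltb s (4 * wide_gaps n)
  then (s + 4 <= n + 1)%nat /\ wall (wide_gaps n) (s + 4) = true
       /\ wall (wide_gaps n) (s + 1) = false /\ wall (wide_gaps n) (s + 2) = false
       /\ wall (wide_gaps n) (s + 3) = false
  else (s + 3 <= n + 1)%nat /\ wall (wide_gaps n) (s + 3) = true
       /\ wall (wide_gaps n) (s + 1) = false /\ wall (wide_gaps n) (s + 2) = false.
Proof.
  unfold wall, wide_gaps. intros Hn Hs Hw. revert Hw.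
  assert (Hk := Nat.div_mod_eq (n + 1) 3).
  assert (Hr := Nat.mod_upper_bound (n + 1) 3 ltac:(lia)).
  revert Hk Hr. generalize ((n + 1) / 3)%nat, ((n + 1) mod 3)%nat. intros k r Hk Hr.
  assert (r = 0 \/ r = 1 \/ r = 2)%nat as [-> | [-> | ->]] by lia; simpl Nat.mul;
  repeat match goal with
  | |- context [Nat.leb ?a ?b] => destruct (Nat.leb_spec a b); try lia
  | |- context [Nat.ltb ?a ?b] => destruct (Nat.ltb_spec a b); try lia
  end;
  rewrite ?Nat.eqb_eq, ?Nat.eqb_neq; intros Hw; repeat split; lia.
Qed.

Lemma wall_left (n s : nat) : (5 <= n)%nat -> (1 <= s <= n)%nat ->
  wall (wide_gaps n) s = true ->
  if Nat.leb s (4 * wide_gaps n)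
  then (4 <= s)%nat /\ wall (wide_gaps n) (s - 4) = true
       /\ wall (wide_gaps n) (s - 1) = false /\ wall (wide_gaps n) (s - 2) = false
       /\ wall (wide_gaps n) (s - 3) = false
  else (3 <= s)%nat /\ wall (wide_gaps n) (s - 3) = true
       /\ wall (wide_gaps n) (s - 1) = false /\ wall (wide_gaps n) (s - 2) = false.
Proof.
  unfold wall, wide_gaps. intros Hn Hs Hw. revert Hw.
  assert (Hk := Nat.div_mod_eq (n + 1) 3).
  assert (Hr := Nat.mod_upper_bound (n + 1) 3 ltac:(lia)).
  revert Hk Hr. generalize ((n + 1) / 3)%nat, ((n + 1) mod 3)%nat. intros k r Hk Hr.
  assert (r = 0 \/ r = 1 \/ r = 2)%nat as [-> | [-> | ->]] by lia; simpl Nat.mul;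
  repeat match goal with
  | |- context [Nat.leb ?a ?b] => destruct (Nat.leb_spec a b); try lia
  | |- context [Nat.ltb ?a ?b] => destruct (Nat.ltb_spec a b); try lia
  end;
  rewrite ?Nat.eqb_eq, ?Nat.eqb_neq; intros Hw; repeat split; lia.
Qed.

Lemma wall_exists (n : nat) : (5 <= n)%nat ->
  exists s, (1 <= s <= n)%nat /\ wall (wide_gaps n) s = true.
Proof.
  intros Hn. exists (if Nat.eqb (wide_gaps n) 0 then 3%nat else 4%nat).
  unfold wall, wide_gaps.
  destruct (Nat.eqb_spec ((n + 1) mod 3) 0) as [->|]; [simpl; lia|].
  split; [lia|]. destruct (Nat.leb_spec 4 (4 * ((n + 1) mod 3))); [reflexivity|lia].
Qed.

(** * Drift of the potential where it is below [q] *)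

Lemma block_term_pos (b0 b1 b2 z p q : R) (wide : bool) (x : nat -> Z) (s i1 i2 i3 : nat) :
  admissible b0 b1 b2 z p q -> 0 < block_term z p q wide x s i1 i2 i3.
Proof.
  intros Hadm. unfold block_term.
  destruct wide; [eapply W3_pos|eapply W2_pos]; eassumption.
Qed.

Lemma block_term_lower (b0 b1 b2 z p q : R) (wide : bool) (x : nat -> Z)
  (s i1 i2 i3 : nat) :
  admissible b0 b1 b2 z p q -> block_term z p q wide x s i1 i2 i3 < q ->
  (x s < x i1)%Z.
Proof.
  intros Hadm H. apply Z.nle_gt. intros Hle. revert H. apply Rle_not_lt.
  unfold block_term.
  destruct wide; [eapply W3_lower|eapply W2_lower]; try eassumption; lia.
Qed.

Lemma wall_term_nonneg (b0 b1 b2 z p q : R) (r : nat) (x : nat -> Z) (s : nat) :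
  admissible b0 b1 b2 z p q -> 0 <= wall_term z p q r x s.
Proof.
  intros Hadm. unfold wall_term. destruct (wall r s); [|apply Rle_refl].
  apply Rlt_le, Rplus_lt_0_compat; eapply block_term_pos; eassumption.
Qed.

Lemma wall_term_le_potential (b0 b1 b2 z p q : R) (n : nat) (x : nat -> Z) (s : nat) :
  admissible b0 b1 b2 z p q -> (1 <= s <= n)%nat ->
  wall_term z p q (wide_gaps n) x s <= potential z p q n x.
Proof.
  intros Hadm Hs. unfold potential.
  apply (Rsum_ge_term (wall_term z p q (wide_gaps n) x)); [|apply in_seq; lia].
  intros j _. eapply wall_term_nonneg; eassumption.
Qed.

Lemma potential_pos (b0 b1 b2 z p q : R) (n : nat) (x : nat -> Z) :
  admissible b0 b1 b2 z p q -> (5 <= n)%nat -> 0 < potential z p q n x.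
Proof.
  intros Hadm Hn. destruct (wall_exists n Hn) as (s & Hs & Hw).
  apply Rlt_le_trans with (wall_term z p q (wide_gaps n) x s).
  - unfold wall_term. rewrite Hw.
    apply Rplus_lt_0_compat; eapply block_term_pos; eassumption.
  - eapply wall_term_le_potential; eassumption.
Qed.

(** All terms are positive, so each block term is below [q], whereas a hole as high as its neighbour
    would make one at least [q]. Such a hole grows at rate [b2]. *)
Lemma wall_low (b0 b1 b2 z p q : R) (n : nat) (x : nat -> Z) (s : nat) :
  admissible b0 b1 b2 z p q -> (1 <= s <= n)%nat ->
  wall (wide_gaps n) s = true -> potential z p q n x < q ->
  (x s < x (s - 1)%nat)%Z /\ (x s < x (s + 1)%nat)%Z.
Proof.
  intros Hadm Hs Hw Hq.
  assert (H := wall_term_le_potential _ _ _ _ _ _ _ x s Hadm Hs).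
  unfold wall_term in H. rewrite Hw in H.
  match type of H with ?u + ?v <= _ =>
    assert (0 < u) by (eapply block_term_pos; eassumption);
    assert (0 < v) by (eapply block_term_pos; eassumption);
    assert (u < q) by lra; assert (v < q) by lra end.
  split; eapply block_term_lower; eassumption.
Qed.

Lemma Vj_interior (n : nat) (x : nat -> Z) (j : nat) : (1 <= j <= n)%nat ->
  Vj n x j = (Nat.b2n (Z.ltb (x j) (bnd n x (j - 1)))
              + Nat.b2n (Z.ltb (x j) (bnd n x (j + 1))))%nat.
Proof.
  intros Hj. unfold Vj. replace (bnd n x j) with (x j); [reflexivity|].
  unfold bnd. destruct (Nat.eqb_spec j 0), (Nat.ltb_spec n j); simpl; lia || reflexivity.
Qed.

Lemma bnd_interior (n : nat) (x : nat -> Z) (j : nat) : (1 <= j <= n)%nat ->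
  bnd n x j = x j.
Proof.
  intros Hj. unfold bnd.
  destruct (Nat.eqb_spec j 0), (Nat.ltb_spec n j); simpl; lia || reflexivity.
Qed.

(** Interior walls are low by [wall_low], boundary walls because heights are nonnegative. Hence no
    wall contributes to the rate of a block site, and each block evolves by itself. *)
Lemma bnd_wall (b0 b1 b2 z p q : R) (n : nat) (x : nat -> Z) (w j : nat) :
  admissible b0 b1 b2 z p q -> (forall i, (1 <= i <= n)%nat -> (0 <= x i)%Z) ->
  potential z p q n x < q ->
  wall (wide_gaps n) w = true -> (1 <= j <= n)%nat -> (j = w + 1 \/ w = j + 1)%nat ->
  Z.ltb (x j) (bnd n x w) = false.
Proof.
  intros Hadm Hx Hq Hw Hj Hjw. apply Z.ltb_ge. unfold bnd.
  destruct (Nat.eqb_spec w 0), (Nat.ltb_spec n w); simpl; try (apply Hx; assumption).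
  destruct (wall_low _ _ _ _ _ _ n x w Hadm ltac:(lia) Hw Hq).
  destruct Hjw as [-> | ->]; [|replace (j + 1 - 1)%nat with j in * by lia]; lia.
Qed.

Ltac nodup_incl :=
  first [ now repeat (constructor; [simpl; lia|]); constructor
        | intros ? ?; simpl in *; apply in_seq; lia ].

Lemma wall_term_drift (b0 b1 b2 z p q : R) (n : nat) (x : nat -> Z) (s : nat) :
  admissible b0 b1 b2 z p q -> (5 <= n)%nat ->
  (forall i, (1 <= i <= n)%nat -> (0 <= x i)%Z) ->
  potential z p q n x < q -> (1 <= s <= n)%nat ->
  drift n b0 b1 b2 (fun x => wall_term z p q (wide_gaps n) x s) x <= 0.
Proof.
  intros Hadm Hn Hx Hq Hs.
  unfold wall_term. destruct (wall (wide_gaps n) s) eqn:Hw.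
  2:{ unfold drift. rewrite (Rsum_ext _ (fun _ => 0)), Rsum_zero by (intros; ring).
      apply Rle_refl. }
  set (f := fun x => block_term z p q (Nat.leb s (4 * wide_gaps n)) x s
                       (s - 1) (s - 2) (s - 3)).
  set (g := fun x => block_term z p q (Nat.ltb s (4 * wide_gaps n)) x s
                       (s + 1) (s + 2) (s + 3)).
  assert (Hfg : drift n b0 b1 b2 (fun x => f x + g x) x
                = drift n b0 b1 b2 f x + drift n b0 b1 b2 g x).
  { unfold drift. rewrite <- Rsum_plus. apply Rsum_ext. intros. ring. }
  change (drift n b0 b1 b2 (fun x => f x + g x) x <= 0). rewrite Hfg.
  destruct (wall_low _ _ _ _ _ _ n x s Hadm Hs Hw Hq) as [Hl Hr].
  assert (WL := wall_left n s Hn Hs Hw). assert (WR := wall_right n s Hn Hs Hw).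
  assert (Vs : Vj n x s = 2%nat).
  { rewrite Vj_interior, !bnd_interior
      by (destruct (Nat.leb s _), (Nat.ltb s _); lia).
    apply Z.ltb_lt in Hl, Hr. now rewrite Hl, Hr. }
  assert (Hwall : forall w j, wall (wide_gaps n) w = true -> (1 <= j <= n)%nat ->
            (j = w + 1 \/ w = j + 1)%nat -> Z.ltb (x j) (bnd n x w) = false)
    by (intros; eapply bnd_wall; eassumption).
  enough (drift n b0 b1 b2 f x <= 0 /\ drift n b0 b1 b2 g x <= 0) by lra.
  split.
  - unfold f; clear f g Hfg. destruct (Nat.leb s (4 * wide_gaps n)).
    + destruct WL as (Hs4 & W4 & _).
      apply wide_term_drift; try assumption; try nodup_incl; rewrite Vj_interior by lia.
      * replace (s - 1 - 1)%nat with (s - 2)%nat by lia.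
        replace (s - 1 + 1)%nat with s by lia.
        rewrite (Hwall s) by (assumption || lia).
        rewrite bnd_interior by lia. apply Nat.add_0_r.
      * replace (s - 2 - 1)%nat with (s - 3)%nat by lia.
        replace (s - 2 + 1)%nat with (s - 1)%nat by lia.
        rewrite !bnd_interior by lia. apply Nat.add_comm.
      * replace (s - 3 - 1)%nat with (s - 4)%nat by lia.
        replace (s - 3 + 1)%nat with (s - 2)%nat by lia.
        rewrite (Hwall (s - 4)%nat), bnd_interior by (assumption || lia). reflexivity.
    + destruct WL as (Hs3 & W3 & _).
      apply narrow_term_drift; try assumption; try nodup_incl; rewrite Vj_interior by lia.
      * replace (s - 1 - 1)%nat with (s - 2)%nat by lia.
        replace (s - 1 + 1)%nat with s by lia.
        rewrite (Hwall s) by (assumption || lia).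
        rewrite bnd_interior by lia. apply Nat.add_0_r.
      * replace (s - 2 - 1)%nat with (s - 3)%nat by lia.
        replace (s - 2 + 1)%nat with (s - 1)%nat by lia.
        rewrite (Hwall (s - 3)%nat), bnd_interior by (assumption || lia). reflexivity.
  - unfold g; clear f g Hfg. destruct (Nat.ltb s (4 * wide_gaps n)).
    + destruct WR as (Hs4 & W4 & _).
      apply wide_term_drift; try assumption; try nodup_incl; rewrite Vj_interior by lia.
      * replace (s + 1 - 1)%nat with s by lia.
        replace (s + 1 + 1)%nat with (s + 2)%nat by lia.
        rewrite (Hwall s), bnd_interior by (assumption || lia). reflexivity.
      * replace (s + 2 - 1)%nat with (s + 1)%nat by lia.
        replace (s + 2 + 1)%nat with (s + 3)%nat by lia.
        rewrite !bnd_interior by lia. reflexivity.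
      * replace (s + 3 - 1)%nat with (s + 2)%nat by lia.
        replace (s + 3 + 1)%nat with (s + 4)%nat by lia.
        rewrite (Hwall (s + 4)%nat), bnd_interior by (assumption || lia).
        apply Nat.add_0_r.
    + destruct WR as (Hs3 & W3 & _).
      apply narrow_term_drift; try assumption; try nodup_incl; rewrite Vj_interior by lia.
      * replace (s + 1 - 1)%nat with s by lia.
        replace (s + 1 + 1)%nat with (s + 2)%nat by lia.
        rewrite (Hwall s), bnd_interior by (assumption || lia). reflexivity.
      * replace (s + 2 - 1)%nat with (s + 1)%nat by lia.
        replace (s + 2 + 1)%nat with (s + 3)%nat by lia.
        rewrite (Hwall (s + 3)%nat), bnd_interior by (assumption || lia).
        apply Nat.add_0_r.
Qed.

Lemma potential_drift (b0 b1 b2 z p q : R) (n : nat) (x : nat -> Z) :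
  admissible b0 b1 b2 z p q -> (5 <= n)%nat ->
  (forall i, (1 <= i <= n)%nat -> (0 <= x i)%Z) -> potential z p q n x < q ->
  drift n b0 b1 b2 (potential z p q n) x <= 0.
Proof.
  intros Hadm Hn Hx Hq.
  apply Rle_trans with
    (Rsum (fun s => drift n b0 b1 b2 (fun x => wall_term z p q (wide_gaps n) x s) x)
          (seq 1 n)).
  (* Linearity of the generator, by exchanging the sums over jumps and over walls. *)
  - right. unfold drift at 2. rewrite Rsum_swap. apply Rsum_ext. intros j _.
    rewrite Rsum_scal. f_equal. unfold potential, Rminus.
    rewrite Rsum_plus. f_equal.
    replace (- Rsum (wall_term z p q (wide_gaps n) x) (seq 1 n))
      with (-1 * Rsum (wall_term z p q (wide_gaps n) x) (seq 1 n)) by ring.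
    rewrite <- Rsum_scal. apply Rsum_ext. intros. ring.
  - rewrite <- (Rsum_zero (seq 1 n)). apply Rsum_le. intros s Hs.
    apply wall_term_drift; try assumption. apply in_seq in Hs. lia.
Qed.

(** The potential sees only heights relative to holes. The case [k = 0] makes it a function of the
    shape; a positive [k] makes it small. *)
Lemma potential_raise (z p q : R) (n : nat) (x x' : nat -> Z) (k c : Z) :
  0 < z -> (5 <= n)%nat ->
  (forall i, (1 <= i <= n)%nat ->
     x' i = x i + (if wall (wide_gaps n) i then 0 else k) + c)%Z ->
  potential z p q n x' = powerRZ z k * potential z p q n x.
Proof.
  intros Hz Hn Hx. unfold potential. rewrite <- Rsum_scal. apply Rsum_ext.
  intros s Hs. apply in_seq in Hs. unfold wall_term.
  destruct (wall (wide_gaps n) s) eqn:Hw; [|ring].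
  assert (WL := wall_left n s Hn ltac:(lia) Hw).
  assert (WR := wall_right n s Hn ltac:(lia) Hw).
  assert (Hd : forall i, (1 <= i <= n)%nat -> wall (wide_gaps n) i = false ->
                 (x' i - x' s = x i - x s + k)%Z).
  { intros i Hi Hwi. rewrite !Hx, Hw, Hwi by lia. lia. }
  rewrite Rmult_plus_distr_l. unfold block_term. f_equal.
  - destruct (Nat.leb s (4 * wide_gaps n)); decompose [and] WL.
    + rewrite !Hd by (assumption || lia). now apply W3_shift.
    + rewrite !Hd by (assumption || lia). now apply W2_shift.
  - destruct (Nat.ltb s (4 * wide_gaps n)); decompose [and] WR.
    + rewrite !Hd by (assumption || lia). now apply W3_shift.
    + rewrite !Hd by (assumption || lia). now apply W2_shift.
Qed.

(** * From the potential to transience *)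

Lemma potential_step_mean (b0 b1 b2 z p q : R) (n : nat) (y : list Z) :
  admissible b0 b1 b2 z p q -> (5 <= n)%nat -> potential z p q n (lift n y) < q ->
  Rsum (fun j => jump_prob n b0 b1 b2 y j * potential z p q n (lift n (shape_step n y j)))
       (seq 1 n) <= potential z p q n (lift n y).
Proof.
  intros Hadm Hn Hq. set (F := potential z p q n) in *.
  assert (0 < b0 /\ 0 < b1 /\ 0 < b2 /\ 0 < z) as (H0 & H1 & H2 & Hz)
    by (destruct Hadm; repeat split; lra).
  assert (HT := total_rate_pos n b0 b1 b2 y ltac:(lia) H0 H1 H2).
  (* The mean increment over one jump is the drift divided by the total rate. *)
  rewrite (Rsum_ext _ (fun j => F (lift n y) * jump_prob n b0 b1 b2 y j
    + / total_rate n b0 b1 b2 y *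
      (beta b0 b1 b2 (Vj n (lift n y) j) * (F (bump (lift n y) j) - F (lift n y))))).
  - rewrite Rsum_plus, !Rsum_scal, jump_prob_sum by (assumption || lia).
    assert (D : drift n b0 b1 b2 F (lift n y) <= 0).
    { apply potential_drift; try assumption. intros i Hi. apply lift_nonneg. lia. }
    unfold drift in D. apply Rinv_0_lt_compat in HT. nra.
  - intros j _. destruct (lift_step n y j) as [c Hc].
    unfold F at 1.
    rewrite (potential_raise z p q n (bump (lift n y) j) _ 0 c); try assumption.
    + simpl. fold F. unfold jump_prob, rate. field. lra.
    + intros i Hi. rewrite Hc by assumption. unfold bump.
      destruct (wall _ i); lia.
Qed.

Lemma hit_le_potential (b0 b1 b2 z p q : R) (n : nat) (h : list Z) :
  admissible b0 b1 b2 z p q -> (5 <= n)%nat ->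
  let F y := potential z p q n (lift n y) in
  let c := Rmin q (F h) in
  forall N y, hit n b0 b1 b2 h N y <= Rmin (F y) c / c.
Proof.
  intros Hadm Hn F c.
  assert (0 < b0 /\ 0 < b1 /\ 0 < b2 /\ 0 < q) as (H0 & H1 & H2 & Hq0)
    by (destruct Hadm; repeat split; lra).
  assert (HF : forall y, 0 < F y)
    by (intros y; eapply potential_pos; eassumption).
  assert (Hc : 0 < c) by (apply Rmin_glb_lt; auto).
  assert (Hdiv : forall u v, u <= v -> u / c <= v / c).
  { intros u v Huv. apply Rmult_le_compat_r; [|assumption].
    now apply Rlt_le, Rinv_0_lt_compat. }
  assert (Hcc : c / c = 1) by (field; lra).
  assert (Hmean : forall y,
    Rsum (fun j => jump_prob n b0 b1 b2 y j * Rmin (F (shape_step n y j)) c) (seq 1 n) <= c).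
  { intros y. apply Rle_trans with (c * Rsum (jump_prob n b0 b1 b2 y) (seq 1 n));
      [|rewrite jump_prob_sum by (assumption || lia); lra].
    rewrite <- Rsum_scal. apply Rsum_le. intros j _. rewrite Rmult_comm.
    apply Rmult_le_compat_r; [|apply Rmin_r].
    apply Rlt_le, jump_prob_pos; assumption || lia. }
  apply hit_le_supersolution; try assumption; try lia.
  - intros y. apply Rlt_le, Rdiv_lt_0_compat; [|assumption]. now apply Rmin_glb_lt.
  - rewrite Rmin_right by apply Rmin_r. lra.
  - intros y.
    apply Rle_trans with
      (Rsum (fun j => / c * (jump_prob n b0 b1 b2 y j * Rmin (F (shape_step n y j)) c))
            (seq 1 n)); [right; apply Rsum_ext; intros; unfold Rdiv; ring|].
    rewrite Rsum_scal, Rmult_comm. apply Hdiv. apply Rmin_glb.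
    (* Below [q] the drift estimate applies. From [q] on, [c <= q] bounds the mean of the truncated
       function by [F y]. *)
    + destruct (Rlt_le_dec (F y) q) as [Hy|Hy].
      * eapply Rle_trans; [|apply (potential_step_mean b0 b1 b2); eassumption].
        apply Rsum_le. intros j _. apply Rmult_le_compat_l; [|apply Rmin_l].
        apply Rlt_le, jump_prob_pos; assumption || lia.
      * apply Rle_trans with c; [apply Hmean|].
        eapply Rle_trans; [apply Rmin_l|exact Hy].
    + apply Hmean.
Qed.

Definition raise_blocks (n K : nat) : list nat :=
  concat (repeat (filter (fun j => negb (wall (wide_gaps n) j)) (seq 1 n)) K).

Lemma in_raise_blocks (n K j : nat) : In j (raise_blocks n K) ->
  (1 <= j <= n)%nat /\ wall (wide_gaps n) j = false.
Proof.
  intros H. apply in_concat in H as (l & Hl & Hj). apply repeat_spec in Hl as ->.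
  apply filter_In in Hj as [Hj Hw]. apply in_seq in Hj.
  apply Bool.negb_true_iff in Hw. split; [lia|assumption].
Qed.

Lemma count_raise_blocks (n K j : nat) : (1 <= j <= n)%nat ->
  count_occ Nat.eq_dec (raise_blocks n K) j
  = if wall (wide_gaps n) j then 0%nat else K.
Proof.
  intros Hj. unfold raise_blocks. induction K as [|K IH]; simpl.
  - now destruct (wall _ j).
  - rewrite count_occ_app, IH. set (l := filter _ _).
    assert (Hl : NoDup l) by apply NoDup_filter, seq_NoDup.
    destruct (wall (wide_gaps n) j) eqn:Hw.
    + rewrite (proj1 (count_occ_not_In Nat.eq_dec l j)); [reflexivity|].
      intros H. apply filter_In in H as [_ H]. now rewrite Hw in H.
    + rewrite (proj1 (NoDup_count_occ' Nat.eq_dec l) Hl j); [reflexivity|].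
      apply filter_In. rewrite Hw, in_seq. split; [lia|reflexivity].
Qed.

Theorem theorem9 (b0 b2 : R) (hb0 : 0 < b0) (hb2l : b0 < b2) (hb2u : b2 < 2 * b0) :
  exists B : R, B > b0 /\
    forall (b1 : R) (n : nat), b1 > B -> (5 <= n)%nat -> shape_transient n b0 b1 b2.
Proof.
  destruct (admissible_exists b0 b2 hb0 hb2l hb2u) as (z & p & q & B & HB & Hadm).
  exists B. split; [exact HB|]. intros b1 n Hb1 Hn h _.
  specialize (Hadm b1 Hb1).
  assert (H := hit_le_potential _ _ _ _ _ _ n h Hadm Hn). simpl in H.
  set (F := fun y => potential z p q n (lift n y)) in *.
  set (c := Rmin q (F h)) in *.
  assert (HF : 0 < F h) by (eapply potential_pos; eassumption).
  assert (Hc : 0 < c) by (destruct Hadm; apply Rmin_glb_lt; lra).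
  (* [K] is such that [z ^ K * F h < c]: after [K] sweeps over the blocks the bound [F / c] on the
     hitting probability is below 1. *)
  destruct (pow_lt_1_zero z) with (y := c / F h) as [K HK].
  { rewrite Rabs_right; destruct Hadm; lra. }
  { now apply Rdiv_lt_0_compat. }
  specialize (HK K (le_n K)). apply Rabs_def2 in HK as [HK _].
  assert (HFK : F (walk n h (raise_blocks n K)) < c).
  { destruct (lift_walk n h (raise_blocks n K)) as [d Hd]. unfold F.
    rewrite (potential_raise z p q n (lift n h) _ (Z.of_nat K) d).
    - rewrite <- pow_powerRZ. change (z ^ K * F h < c).
      replace c with (c / F h * F h) by (field; lra).
      now apply Rmult_lt_compat_r.
    - now destruct Hadm.
    - assumption.
    - intros i Hi. rewrite Hd, count_raise_blocks by assumption.
      destruct (wall _ i); lia. }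
  (* Any interior wall [s] is left untouched by the sweeps, which is what [walk_neq] asks for. *)
  destruct (wall_exists n Hn) as (s & Hs & Hw).
  apply (escapes_walk n b0 b1 b2 h (raise_blocks n K)); try lra.
  - intros j Hj. now apply in_raise_blocks in Hj.
  - intros p1 j p2 E.
    assert (Hsub : forall i, In i (p1 ++ [j]) -> In i (raise_blocks n K)).
    { intros i Hi. rewrite E. rewrite in_app_iff in *. simpl in *. tauto. }
    apply (walk_neq n h p1 j s Hs).
    + apply (in_raise_blocks n K), Hsub, in_or_app. right. now left.
    + intros Hin. apply Hsub, in_raise_blocks in Hin as [_ Hin]. congruence.
  - exists (F (walk n h (raise_blocks n K)) / c). split.
    + apply (Rmult_lt_reg_r c); [assumption|]. unfold Rdiv.
      rewrite Rmult_assoc, Rinv_l by lra. lra.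
    + intros N. eapply Rle_trans; [apply H|].
      apply Rmult_le_compat_r; [now apply Rlt_le, Rinv_0_lt_compat|apply Rmin_l].
Qed.
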